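(* Let $\&$ be a continuous t-norm on $[0,1]$. For a real-enriched category $X$ (with respect to $\&$), the following are equivalent: (1) $X$ is Smyth complete. (2) Every forward Cauchy net $\{x_i\}_{i\in D}$ of $X$ has a unique bilimit. (3) $X$ is separated and every ideal of $X$ is representable. (4) $X$ is Cauchy complete and every ideal of $X$ is a Cauchy weight. In this case, $X$ is Yoneda complete.
   Context: A continuous t-norm $\&$ is a continuous map $\&\colon[0,1]\times[0,1]\to[0,1]$, non-decreasing in each variable, such that $([0,1],\&,1)$ is a (necessarily commutative) monoid; its implication is $x\to z=\sup\{y\in[0,1]\mid x\& y\le z\}$. Suprema and infima are taken in $[0,1]$. A real-enriched category is a set $X$ with a function $X(-,-)\colon X\times X\to[0,1]$ such that $X(x,x)=1$ and $X(y,z)\& X(x,y)\le X(x,z)$ for all $x,y,z\in X$. It is separated if $X(x,y)=1=X(y,x)$ implies $x=y$. Nets are indexed by (non-empty) directed sets. A net $\{x_i\}_{i\in D}$ of $X$ is forward Cauchy if $\sup_{i\in D}\inf_{k\ge j\ge i}X(x_j,x_k)=1$. A bilimit of it is an element $a$ such that for all $x\in X$: $\sup_{i}\inf_{j\ge i}X(x,x_j)=X(x,a)$ and $\sup_{i}\inf_{j\ge i}X(x_j,x)=X(a,x)$. A Yoneda limit of it is an element $b$ such that for all $x\in X$: $\sup_{i}\inf_{j\ge i}X(x_j,x)=X(b,x)$. $X$ is Yoneda complete if every forward Cauchy net of $X$ has a unique Yoneda limit. The open ball topology of $X$ is the topology with base $\{B(x,r)\mid x\in X, r<1\}$, where $B(x,r)=\{y\in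 X\mid X(x,y)>r\}$. The symmetrization of $X$ is the real-enriched category on the same set with hom $\min\{X(x,y),X(y,x)\}$. $X$ is Smyth complete if each forward Cauchy net of $X$ converges uniquely (i.e. has exactly one limit) in the open ball topology of the symmetrization of $X$. A weight of $X$ is a function $\phi\colon X\to[0,1]$ with $\phi(y)\& X(x,y)\le\phi(x)$ for all $x,y$; a coweight of $X$ is a function $\psi\colon X\to[0,1]$ with $X(x,y)\&\psi(x)\le\psi(y)$ for all $x,y$. The weight $\phi$ is representable if $\phi=X(-,a)$ for some $a\in X$. The weight $\phi$ is Cauchy if it is a right adjoint as a distributor, i.e. there is a coweight $\psi$ of $X$ with $\sup_{x\in X}\phi(x)\&\psi(x)\ge1$ and $\psi(y)\&\phi(x)\le X(x,y)$ for all $x,y\in X$. $X$ is Cauchy complete if it is separated and every Cauchy weight of $X$ is representable. $\mathcal{P}X$ denotes the real-enriched category of all weights of $X$ with hom $\mathrm{sub}_X(\phi_1,\phi_2)=\inf_{x\in X}(\phi_1(x)\to\phi_2(x))$. An ideal of $X$ is a weight $\phi$ such that the functor $\mathrm{sub}_X(\phi,-)\colon\mathcal{P}X\to([0,1],\to)$ preserves finite enriched colimits; equivalently, for all $\lambda,\mu\in\mathcal{P}X$ and $r\in[0,1]$: $\mathrm{sub}_X(\phi,r\&\lambda)=r\&\mathrm{sub}_X(\phi,\lambda)$ and $\mathrm{sub}_X(\phi,\lambda\vee\mu)=\mathrm{sub}_X(\phi,\lambda)\vee\mathrm{sub}_X(\phi,\mu)$ (operations on weights are pointwise). *)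

(* Defs.v *)
From HB Require Import structures.
From mathcomp Require Import all_boot all_order all_algebra.
From mathcomp Require Import all_classical all_reals all_analysis.

Set Implicit Arguments.
Unset Strict Implicit.
Unset Printing Implicit Defensive.

Import Order.TTheory GRing.Theory Num.Theory.
Import numFieldNormedType.Exports.

Local Open Scope classical_set_scope.
Local Open Scope ring_scope.

(* Elements of the unit interval are represented by real numbers together with
   explicit bounds; the binary operation [tn] is only relevant on [0,1]. *)

Section UnitInterval.
Variable R : realType.

Definition unit_interval : Type := {r : R | 0 <= r <= 1}.

(* Suprema and infima computed in the complete lattice [0,1]: inserting the
   bottom (top) element makes the empty supremum 0 (the empty infimum 1). *)
Definition sup01 (A : set R) : R := sup (0 |` A).
Definition inf01 (A : set R) : R := inf (1 |` A).

Lemma inf01_itv (A : set R) :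
  (forall a, A a -> 0 <= a) -> 0 <= inf01 A <= 1.
Proof.
move=> A0; have lb0 : lbound (1 |` A) 0 by move=> a [->|/A0].
apply/andP; split; first by apply: lb_le_inf => //; exists 1; left.
by apply: ge_inf; [exists 0|left].
Qed.

(* Commutativity is a consequence of these conditions. *)
Definition continuous_tnorm (tn : R -> R -> R) : Prop :=
  [/\ (forall x y : R, 0 <= x <= 1 -> 0 <= y <= 1 -> 0 <= tn x y <= 1),
      {within `[0, 1] `*` `[0, 1], continuous (fun p : R * R => tn p.1 p.2)},
      (forall x x' y y' : R, 0 <= x -> x <= x' -> x' <= 1 ->
         0 <= y -> y <= y' -> y' <= 1 -> tn x y <= tn x' y'),
      (forall x y z : R, 0 <= x <= 1 -> 0 <= y <= 1 -> 0 <= z <= 1 ->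
         tn x (tn y z) = tn (tn x y) z) &
      (forall x : R, 0 <= x <= 1 -> tn 1 x = x /\ tn x 1 = x)].

Definition implication (tn : R -> R -> R) (x z : R) : R :=
  sup01 [set y | 0 <= y <= 1 /\ tn x y <= z].

Lemma implication_ge0 tn x z : 0 <= implication tn x z.
Proof.
apply: ub_le_sup; last by left.
by exists 1 => y [->|[/andP[_ ]]].
Qed.

End UnitInterval.

Section RealEnriched.
Variables (R : realType) (tn : R -> R -> R).

Definition real_enriched (X : Type) (h : X -> X -> R) : Prop :=
  [/\ (forall x y, 0 <= h x y <= 1),
      (forall x, h x x = 1) &
      (forall x y z, tn (h y z) (h x y) <= h x z)].

Definition separated_cat (X : Type) (h : X -> X -> R) : Prop :=
  forall x y, h x y = 1 -> h y x = 1 -> x = y.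

Definition symmetrization (X : Type) (h : X -> X -> R) : X -> X -> R :=
  fun x y => Num.min (h x y) (h y x).

Definition enriched_functor (X Y : Type) (hX : X -> X -> R) (hY : Y -> Y -> R)
    (F : X -> Y) : Prop :=
  forall x y, hX x y <= hY (F x) (F y).

Definition weight (X : Type) (h : X -> X -> R) (phi : X -> R) : Prop :=
  (forall x, 0 <= phi x <= 1) /\
  (forall x y, tn (phi y) (h x y) <= phi x).

Definition coweight (X : Type) (h : X -> X -> R) (psi : X -> R) : Prop :=
  (forall x, 0 <= psi x <= 1) /\
  (forall x y, tn (h x y) (psi x) <= psi y).

Definition representable (X : Type) (h : X -> X -> R) (phi : X -> R) : Prop :=
  exists a, forall x, phi x = h x a.

Definition cauchy_weight (X : Type) (h : X -> X -> R) (phi : X -> R) : Prop :=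
  weight h phi /\
  exists psi, [/\ coweight h psi,
    sup01 [set tn (phi x) (psi x) | x in [set: X]] >= 1 &
    forall x y, tn (psi y) (phi x) <= h x y].

Definition cauchy_complete (X : Type) (h : X -> X -> R) : Prop :=
  separated_cat h /\ forall phi, cauchy_weight h phi -> representable h phi.

Definition weights (X : Type) (h : X -> X -> R) : Type :=
  {phi : X -> R | weight h phi}.

Definition sub_hom (X : Type) (phi1 phi2 : X -> R) : R :=
  inf01 [set implication tn (phi1 x) (phi2 x) | x in [set: X]].

Definition weights_hom (X : Type) (h : X -> X -> R)
    (phi1 phi2 : weights h) : R := sub_hom (sval phi1) (sval phi2).

Definition unit_interval_hom (a b : unit_interval R) : R :=
  implication tn (sval a) (sval b).

Lemma sub_hom_itv (X : Type) (phi1 phi2 : X -> R) :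
  0 <= sub_hom phi1 phi2 <= 1.
Proof. by apply: inf01_itv => _ [x _ <-]; exact: implication_ge0. Qed.

Definition sub_functor (X : Type) (h : X -> X -> R) (phi : X -> R)
    (lambda : weights h) : unit_interval R :=
  exist _ (sub_hom phi (sval lambda)) (sub_hom_itv phi (sval lambda)).

(* c is the colimit of F weighted by W, i.e. hom(c, y) is the degree to which
   W is below hom(F -, y). *)
Definition is_colimit (C : Type) (hC : C -> C -> R) (D : Type)
    (W : D -> R) (F : D -> C) (c : C) : Prop :=
  forall y, hC c y = sub_hom W (fun d => hC (F d) y).

(* Finite means that the indexing category has finitely many objects. *)
Definition preserves_finite_colimits (C E : Type) (hC : C -> C -> R)
    (hE : E -> E -> R) (G : C -> E) : Prop :=
  forall (D : finType) (hD : D -> D -> R) (W : D -> R) (F : D -> C) (c : C),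
    real_enriched hD -> weight hD W -> enriched_functor hD hC F ->
    is_colimit hC W F c -> is_colimit hE W (G \o F) (G c).

Definition ideal (X : Type) (h : X -> X -> R) (phi : X -> R) : Prop :=
  weight h phi /\
  preserves_finite_colimits (@weights_hom X h) unit_interval_hom
    (@sub_functor X h phi).

End RealEnriched.

Record directed_set := DirectedSet {
  directed_sort :> Type;
  dle : directed_sort -> directed_sort -> Prop;
  dle_refl : forall i, dle i i;
  dle_trans : forall i j k, dle i j -> dle j k -> dle i k;
  dle_inhabited : inhabited directed_sort;
  dle_directed : forall i j, exists k, dle i k /\ dle j k
}.

Definition tails (D : directed_set) : set_system D :=
  [set A | exists i, forall j, dle i j -> A j].
Arguments tails : clear implicits.

(* The topology on X generated by the balls B(x, r), r < 1.  For a
   real-enriched category over a continuous t-norm these form a base. *)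
Definition open_ball_space (R : realType) (X : Type) (h : X -> X -> R) : Type :=
  X.

Section OpenBallTopology.
Variables (R : realType) (X : Type) (h : X -> X -> R).

Definition open_ball (x : X) (r : R) : set X := [set y | r < h x y].

Definition open_balls : set (set X) :=
  [set B | exists x r, r < 1 /\ B = open_ball x r].

HB.instance Definition _ := gen_eqMixin (open_ball_space h).
HB.instance Definition _ := gen_choiceMixin (open_ball_space h).
HB.instance Definition _ :=
  isSubBaseTopological.Build (open_ball_space h) open_balls id.

End OpenBallTopology.

Section Nets.
Variables (R : realType) (X : Type) (h : X -> X -> R).

Definition net_liminf (D : directed_set) (f : D -> R) : R :=
  sup01 [set inf01 [set f j | j in [set j | dle i j]] | i in [set: D]].

Definition forward_cauchy (D : directed_set) (x : D -> X) : Prop :=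
  sup01 [set inf01 [set r | exists j k, [/\ dle i j, dle j k &
                                            r = h (x j) (x k)]]
        | i in [set: D]] = 1.

Definition yoneda_limit (D : directed_set) (x : D -> X) (b : X) : Prop :=
  forall y, net_liminf (fun j => h (x j) y) = h b y.

Definition bilimit (D : directed_set) (x : D -> X) (a : X) : Prop :=
  forall y, net_liminf (fun j => h y (x j)) = h y a /\
            net_liminf (fun j => h (x j) y) = h a y.

Definition yoneda_complete : Prop :=
  forall (D : directed_set) (x : D -> X),
    forward_cauchy x -> exists! b, yoneda_limit x b.

Definition sym_converges (D : directed_set) (x : D -> X) (a : X) : Prop :=
  let S := open_ball_space (symmetrization h) in
  (x : D -> S) @ tails D --> (a : S).

Definition smyth_complete : Prop :=
  forall (D : directed_set) (x : D -> X),
    forward_cauchy x -> exists! a, sym_converges x a.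

End Nets.

(* Main.v *)
Require Import Defs.
From mathcomp Require Import all_boot all_order all_algebra.
From mathcomp Require Import all_classical all_reals all_analysis.
From mathcomp Require Import finmap lra.

(** A net converges to a point a in the open ball topology of the
    symmetrization exactly when X(a, x_j) and X(x_j, a) both tend to 1, and by
    the triangle inequality and the continuity of the t-norm at 1 this says
    exactly that a is a bilimit ([sym_converges_bilimit]).  So (1) and (2) are
    the same condition, net by net.

    Conditions (2) and (3) are linked by the weights
    liminf_j X(-, x_j) of forward Cauchy nets ([net_weight]).  Such a weight
    phi is represented by a iff a is a bilimit of the net, because phi(x_j)
    tends to 1 ([representing_bilimit]).  The theorem therefore rests on the
    fact that the ideals are precisely the weights of forward Cauchy nets.

    - Every weight of a forward Cauchy net is an ideal
      ([net_weight_ideal]).  For a weight lambda the values lambda(x_j) are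
      almost decreasing along the net and tend to sub(phi, lambda); a finite
      weighted join that is large along the net has, by the pigeonhole
      principle, one single component that is large cofinally, hence
      eventually.
    - Every ideal phi comes from a net ([net_weight_ideal_net]).  Preservation
      of finite joins, applied to the weights X(x, -) -> r and to a constant,
      shows that phi is directed in a quantitative sense: if r_d < phi(x_d)
      for finitely many d and t < 1, some z satisfies t < phi(z) and
      r_d < X(x_d, z) for all d ([ideal_directed]).  Hence the pairs (x, r)
      with r < phi(x), ordered by (x, r) <= (y, s) iff r <= s & X(x, y), form
      a directed set, and (x, r) |-> x is the required net.

    Cauchy weights are ideals, as sub(phi, lambda) = sup_x lambda(x) & psi(x)
    for a right adjoint phi with left adjoint psi ([cauchy_weight_ideal]), and
    representable weights are Cauchy; this gives the equivalence of (3)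
    and (4).

    All of this uses the commutativity of the t-norm, which is derived from
    continuity and associativity in [tnC]: below an idempotent everything
    commutes with what lies above it, and between two idempotents any two
    elements are squeezed between consecutive powers of a third one. *)

Set Implicit Arguments.
Unset Strict Implicit.
Unset Printing Implicit Defensive.

Import Order.TTheory GRing.Theory Num.Theory.
Import numFieldNormedType.Exports.

Local Open Scope classical_set_scope.
Local Open Scope ring_scope.

(** * Suprema and infima in the unit interval *)

Section UnitIntervalSupInf.
Variable R : realType.
Implicit Types (A : set R) (c : R).

Lemma sup01_le A c : 0 <= c -> (forall a, A a -> a <= c) -> sup01 A <= c.
Proof.
move=> c0 Ac; apply: ge_sup; first by exists 0; left.
by move=> x [->|/Ac].
Qed.

Lemma le_sup01 A a : (forall a, A a -> a <= 1) -> A a -> a <= sup01 A.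
Proof.
move=> A1 Aa; apply: ub_le_sup; last by right.
by exists 1 => x [->|/A1].
Qed.

Lemma sup01_itv A : (forall a, A a -> a <= 1) -> 0 <= sup01 A <= 1.
Proof.
move=> A1; rewrite sup01_le // andbT; apply: ub_le_sup; last by left.
by exists 1 => x [->|/A1].
Qed.

Lemma lt_sup01 A c : 0 <= c -> c < sup01 A -> exists2 a, A a & c < a.
Proof.
move=> c0 /sup_gt[|a [->|Aa ca]]; first by exists 0; left.
  by rewrite ltNge c0.
by exists a.
Qed.

Lemma le_inf01 A c : c <= 1 -> (forall a, A a -> c <= a) -> c <= inf01 A.
Proof.
move=> c1 Ac; apply: lb_le_inf; first by exists 1; left.
by move=> x [->|/Ac].
Qed.

Lemma inf01_le A a : (forall a, A a -> 0 <= a) -> A a -> inf01 A <= a.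
Proof.
move=> A0 Aa; apply: ge_inf; last by right.
by exists 0 => x [->|/A0].
Qed.

Lemma inf01_lt A c : c <= 1 -> inf01 A < c -> exists2 a, A a & a < c.
Proof.
move=> c1 /inf_lt[|a [->|Aa ac]]; first by exists 1; left.
  by rewrite ltNge c1.
by exists a.
Qed.

End UnitIntervalSupInf.

(** * Limits inferior of nets in the unit interval *)

Section Nets.
Variables (R : realType) (D : directed_set).
Implicit Types (f : D -> R) (c r : R).

Lemma tailsI (A B : set D) : tails D A -> tails D B -> tails D (A `&` B).
Proof.
move=> [i Ai] [j Bj]; have [k [ik jk]] := dle_directed i j.
by exists k => l kl; split; [apply: Ai|apply: Bj]; exact: dle_trans kl.
Qed.

Lemma tailsS (A B : set D) : A `<=` B -> tails D A -> tails D B.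
Proof. by move=> AB [i Ai]; exists i => j /Ai/AB. Qed.

Lemma tails_nonempty (A : set D) : tails D A -> A !=set0.
Proof. by move=> [i Ai]; exists i; apply: Ai; exact: dle_refl. Qed.

Lemma tailsT : tails D setT.
Proof. by have [i] := dle_inhabited D; exists i. Qed.

Let inf_itv f i : (forall j, 0 <= f j <= 1) ->
  0 <= inf01 [set f j | j in [set j | dle i j]] <= 1.
Proof. by move=> If; apply: inf01_itv => _ [j _ <-]; case/andP: (If j). Qed.

Lemma net_liminf_itv f : (forall j, 0 <= f j <= 1) -> 0 <= net_liminf f <= 1.
Proof.
by move=> If; apply: sup01_itv => _ [i _ <-]; case/andP: (inf_itv i If).
Qed.

Lemma le_net_liminf f c : (forall j, 0 <= f j <= 1) -> c <= 1 ->
  (forall r, r < c -> tails D [set j | r <= f j]) -> c <= net_liminf f.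
Proof.
move=> If c1 H; rewrite leNgt; apply/negP => lc.
have [|i Hi] := H ((net_liminf f + c) / 2); first by lra.
have : inf01 [set f j | j in [set j | dle i j]] <= net_liminf f.
  by apply: le_sup01 => [_ [k _ <-]|]; [case/andP: (inf_itv k If)|exists i].
have : (net_liminf f + c) / 2 <= inf01 [set f j | j in [set j | dle i j]].
  by apply: le_inf01 => [|_ [j ij <-]]; [lra|exact: Hi].
lra.
Qed.

Lemma net_liminf_le f c : (forall j, 0 <= f j <= 1) -> 0 <= c ->
  (forall r, 0 <= r <= 1 -> tails D [set j | r <= f j] -> r <= c) ->
  net_liminf f <= c.
Proof.
move=> If c0 H; apply: sup01_le => // _ [i _ <-].
apply: H; first exact: inf_itv.
exists i => j ij; apply: inf01_le; last by exists j.
by move=> _ [k _ <-]; case/andP: (If k).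
Qed.

Lemma tails_net_liminf f r : (forall j, 0 <= f j <= 1) ->
  r < net_liminf f -> tails D [set j | r <= f j].
Proof.
move=> If rl; have [r0|r0] := ltP r 0.
  apply: tailsS tailsT => j _; have /andP[fj _] := If j.
  by apply: le_trans fj; exact: ltW.
have [_ [i _ <-] ri] := lt_sup01 r0 rl; exists i => j ij.
apply: le_trans (ltW ri) _; apply: inf01_le; last by exists j.
by move=> _ [k _ <-]; case/andP: (If k).
Qed.

Lemma forward_cauchyP (X : Type) (h : X -> X -> R) (x : D -> X) :
  (forall x y, 0 <= h x y <= 1) ->
  forward_cauchy h x <-> forall t, t < 1 ->
    exists i, forall j k, dle i j -> dle j k -> t <= h (x j) (x k).
Proof.
move=> Ih.
pose A i := [set r | exists j k, [/\ dle i j, dle j k & r = h (x j) (x k)]].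
rewrite /forward_cauchy -[sup01 _]/(sup01 [set inf01 (A i) | i in [set: D]]).
have A0 i r : A i r -> 0 <= r.
  by move=> [j [k [_ _ ->]]]; case/andP: (Ih (x j) (x k)).
have A1 r : [set inf01 (A i) | i in [set: D]] r -> r <= 1.
  by move=> [i _ <-]; case/andP: (inf01_itv (@A0 i)).
split=> [E t t1|H].
  have [t0|t0] := ltP t 0.
    have [i] := dle_inhabited D; exists i => j k _ _.
    by apply: le_trans (ltW t0) _; case/andP: (Ih (x j) (x k)).
  have [|_ [i _ <-] ti] := @lt_sup01 _ [set inf01 (A i) | i in [set: D]] t t0.
    by rewrite E.
  exists i => j k ij jk; apply: le_trans (ltW ti) _.
  by apply: inf01_le; [exact: A0|exists j, k].
apply/eqP; rewrite eq_le (andP (sup01_itv A1)).2 /= leNgt; apply/negP.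
set s := sup01 _ => s1; have [|i Hi] := H ((s + 1) / 2); first by lra.
have : inf01 (A i) <= s by apply: le_sup01 => //; exists i.
have : (s + 1) / 2 <= inf01 (A i).
  by apply: le_inf01 => [|_ [j [k [ij jk ->]]]]; [lra|exact: Hi].
lra.
Qed.

End Nets.

#[local] Instance tails_filter (D : directed_set) : Filter (tails D).
Proof. by split; [exact: tailsT|exact: tailsI|exact: tailsS]. Qed.

(** * Continuous t-norms *)

Section Tnorm.
Variables (R : realType) (tn : R -> R -> R) (htn : continuous_tnorm tn).

Lemma tn_itv x y : 0 <= x <= 1 -> 0 <= y <= 1 -> 0 <= tn x y <= 1.
Proof. by case: htn => H _ _ _ _; exact: H. Qed.

Lemma le_tn x x' y y' : 0 <= x <= 1 -> 0 <= x' <= 1 -> 0 <= y <= 1 ->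
  0 <= y' <= 1 -> x <= x' -> y <= y' -> tn x y <= tn x' y'.
Proof.
case: htn => _ _ H _ _ /andP[x0 _] /andP[_ x1] /andP[y0 _] /andP[_ y1] xx yy.
exact: H.
Qed.

Lemma tnA x y z : 0 <= x <= 1 -> 0 <= y <= 1 -> 0 <= z <= 1 ->
  tn x (tn y z) = tn (tn x y) z.
Proof. by case: htn => _ _ _ H _; exact: H. Qed.

Lemma tn1x x : 0 <= x <= 1 -> tn 1 x = x.
Proof. by case: htn => _ _ _ _ H /H[]. Qed.

Lemma tnx1 x : 0 <= x <= 1 -> tn x 1 = x.
Proof. by case: htn => _ _ _ _ H /H[]. Qed.

Lemma itv1 : 0 <= (1 : R) <= 1. Proof. by rewrite ler01 lexx. Qed.
Lemma itv0 : 0 <= (0 : R) <= 1. Proof. by rewrite ler01 lexx. Qed.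

Lemma tn_lel x y : 0 <= x <= 1 -> 0 <= y <= 1 -> tn x y <= x.
Proof.
move=> Ix Iy; rewrite -[leRHS](tnx1 Ix).
by apply: le_tn => //; [exact: itv1|case/andP: Iy].
Qed.

Lemma tn_ler x y : 0 <= x <= 1 -> 0 <= y <= 1 -> tn x y <= y.
Proof.
move=> Ix Iy; rewrite -[leRHS](tn1x Iy).
by apply: le_tn => //; [exact: itv1|case/andP: Ix].
Qed.

Lemma tn_cont p q e : 0 <= p <= 1 -> 0 <= q <= 1 -> 0 < e ->
  exists2 d, 0 < d & forall p' q', 0 <= p' <= 1 -> 0 <= q' <= 1 ->
    `|p - p'| < d -> `|q - q'| < d -> `|tn p q - tn p' q'| < e.
Proof.
case: htn => _ /subspace_continuousP C _ _ _ Ip Iq e0.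
have /C/cvgrPdist_lt/(_ _ e0) : (`[0, 1] `*` `[0, 1]) (p, q).
  by split; rewrite /= in_itv.
case=> -[U V] /= [/nbhs_ballP[d1 /= d10 d1U] /nbhs_ballP[d2 /= d20 d2V]] UV.
exists (Num.min d1 d2); first by rewrite lt_min d10.
move=> p' q' Ip' Iq'; rewrite !lt_min => /andP[pd _] /andP[_ qd].
apply: (UV (p', q')); last by split; rewrite /= in_itv.
by split; [exact: d1U|exact: d2V].
Qed.

Lemma implication_itv x z : 0 <= implication tn x z <= 1.
Proof. by apply: sup01_itv => y [/andP[]]. Qed.

Local Ltac itv := solve [repeat first [assumption | exact: itv0 | exact: itv1
  | apply: tn_itv | apply: implication_itv | apply: sub_hom_itv | trivial]].

Lemma min_itv (x y : R) : 0 <= x <= 1 -> 0 <= y <= 1 -> 0 <= Num.min x y <= 1.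
Proof. by case: (leP x y). Qed.

Lemma max_itv (x y : R) : 0 <= x <= 1 -> 0 <= y <= 1 -> 0 <= Num.max x y <= 1.
Proof. by case: (leP x y). Qed.

(** By monotonicity a strict lower bound at a point survives at every point that
    is not much smaller, however much larger it is: continuity is applied at
    the minimum of the two points. *)
Lemma tn_gt_near a b c : 0 <= a <= 1 -> 0 <= b <= 1 -> c < tn a b ->
  exists2 d, 0 < d & forall a' b', 0 <= a' <= 1 -> 0 <= b' <= 1 ->
    a - d < a' -> b - d < b' -> c < tn a' b'.
Proof.
move=> Ia Ib cab; have e0 : 0 < tn a b - c by lra.
have [d d0 H] := tn_cont Ia Ib e0; exists d => // a' b' Ia' Ib' aa bb.
have Ia2 := min_itv Ia Ia'; have Ib2 := min_itv Ib Ib'.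
have {}H : `|tn a b - tn (Num.min a a') (Num.min b b')| < tn a b - c.
  by apply: H => //; rewrite ltr_norml;
      [case: (leP a a')|case: (leP b b')] => ?; apply/andP; split; lra.
apply: (@lt_le_trans _ _ (tn (Num.min a a') (Num.min b b'))).
  by move: H; rewrite ltr_norml; lra.
by apply: le_tn => //; rewrite ge_min lexx orbT.
Qed.

(** Dually, strict upper bounds persist, by passing to the maximum. *)
Lemma tn_lt_near a b c : 0 <= a <= 1 -> 0 <= b <= 1 -> tn a b < c ->
  exists2 d, 0 < d & forall a' b', 0 <= a' <= 1 -> 0 <= b' <= 1 ->
    a' < a + d -> b' < b + d -> tn a' b' < c.
Proof.
move=> Ia Ib cab; have e0 : 0 < c - tn a b by lra.
have [d d0 H] := tn_cont Ia Ib e0; exists d => // a' b' Ia' Ib' aa bb.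
have Ia2 := max_itv Ia Ia'; have Ib2 := max_itv Ib Ib'.
have {}H : `|tn a b - tn (Num.max a a') (Num.max b b')| < c - tn a b.
  by apply: H => //; rewrite ltr_norml;
      [case: (leP a a')|case: (leP b b')] => ?; apply/andP; split; lra.
apply: (@le_lt_trans _ _ (tn (Num.max a a') (Num.max b b'))).
  by apply: le_tn => //; rewrite le_max lexx orbT.
by move: H; rewrite ltr_norml; lra.
Qed.

Lemma itv_IVT (f : R -> R) x :
  (forall p e, 0 <= p <= 1 -> 0 < e -> exists2 d, 0 < d & forall p',
     0 <= p' <= 1 -> `|p - p'| < d -> `|f p - f p'| < e) ->
  f 0 <= x -> x <= f 1 -> exists2 u, 0 <= u <= 1 & f u = x.
Proof.
move=> fC f0 f1.
have C : {within `[0, 1], continuous f}.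
  apply/subspace_continuousP => p /=; rewrite in_itv /= => Ip.
  apply/cvgrPdist_lt => e e0; have [d d0 H] := fC _ _ Ip e0.
  apply/nbhs_ballP; exists d => // p' pp'; rewrite /= in_itv /= => Ip'.
  exact: H.
have [|u] := IVT (@ler01 R) C (v := x).
- by rewrite ge_min f0 le_max f1 orbT.
by rewrite in_itv /= => Iu fu; exists u.
Qed.

(** By the intermediate value theorem x = b & u for some u, so b & x = x follows
    from the idempotence of b; symmetrically on the other side. *)
Lemma tn_idem_absorb b x : 0 <= b <= 1 -> tn b b = b -> 0 <= x -> x <= b ->
  tn b x = x /\ tn x b = x.
Proof.
move=> Ib bb x0 xb.
have I0 := itv0; have I1 := itv1.
have b0l : tn b 0 <= 0 by exact: tn_ler.
have b0r : tn 0 b <= 0 by exact: tn_lel.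
split.
  have [|||u Iu <-] := @itv_IVT (tn b) x; last by rewrite tnA // bb.
  - move=> p e Ip e0; have [d d0 H] := tn_cont Ib Ip e0.
    by exists d => // p' Ip' pp'; apply: H; rewrite ?subrr ?normr0.
  - by lra.
  by rewrite tnx1.
have [|||u Iu <-] := @itv_IVT (tn ^~ b) x; last by rewrite -tnA // bb.
- move=> p e Ip e0; have [d d0 H] := tn_cont Ip Ib e0.
  by exists d => // p' Ip' pp'; apply: H; rewrite ?subrr ?normr0.
- by lra.
by rewrite tn1x.
Qed.

Definition tn_exp (z : R) (n : nat) : R := iter n (tn z) 1.

Lemma tn_exp_itv z n : 0 <= z <= 1 -> 0 <= tn_exp z n <= 1.
Proof. by move=> Iz; elim: n => [|n IHn]; [exact: itv1|exact: tn_itv]. Qed.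

Lemma tn_expD z m n : 0 <= z <= 1 ->
  tn_exp z (m + n) = tn (tn_exp z m) (tn_exp z n).
Proof.
move=> Iz; elim: m => [|m IHm]; first by rewrite tn1x //; exact: tn_exp_itv.
by rewrite addSn /= IHm tnA //; exact: tn_exp_itv.
Qed.

Lemma tn_exp_square z n : 0 <= z <= 1 ->
  tn_exp (tn z z) n = tn_exp z (n + n).
Proof.
move=> Iz; elim: n => [|n IHn] //=.
rewrite IHn addnS /= tnA //; exact: tn_exp_itv.
Qed.

Lemma tn_exp_bracket z x n : x <= 1 -> tn_exp z n < x ->
  exists m, tn_exp z m.+1 <= x <= tn_exp z m.
Proof.
move=> x1 zx; have ex : exists n, tn_exp z n < x by exists n.
have [[|k] kx kmin] := ex_minnP ex.
  by move: kx; rewrite /= ltNge x1.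
exists k; rewrite (ltW kx) leNgt /=; apply/negP => /kmin.
by rewrite ltnn.
Qed.

(** Let z^(k+1) <= x <= z^k and z^(l+1) <= y <= z^l.  Powers of z commute, so
    x & y and y & x both lie between z^(k+l+2) and z^(k+l), and these differ by
    the factor z & z only. *)
Lemma tn_square_swap z x y n : 0 <= z <= 1 -> 0 <= x <= 1 -> 0 <= y <= 1 ->
  tn_exp z n < x -> tn_exp z n < y -> tn (tn z z) (tn y x) <= tn x y.
Proof.
move=> Iz Ix Iy zx zy.
have [_ x1] := andP Ix; have [_ y1] := andP Iy.
have [k /andP[k1 k2]] := tn_exp_bracket x1 zx.
have [l /andP[l1 l2]] := tn_exp_bracket y1 zy.
have IE j := tn_exp_itv j Iz.
apply: (@le_trans _ _ (tn (tn_exp z k.+1) (tn_exp z l.+1))).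
  have -> : tn (tn_exp z k.+1) (tn_exp z l.+1) =
      tn (tn z z) (tn (tn_exp z l) (tn_exp z k)).
    rewrite -(tn_expD k.+1 l.+1 Iz) -(tn_expD l k Iz) -tnA //.
    by rewrite addSn addnS addnC.
  apply: le_tn => //; try itv.
  by apply: le_tn.
by apply: le_tn.
Qed.

(** Let x <= y and let b be the infimum of the z all of whose powers stay above
    x; it is idempotent.  If b <= y, then b separates x from y and both products
    equal x.  If y < b, every z in ]y, b[ has a power below x, so that
    [tn_square_swap] gives z & z & (y & x) <= x & y, and z tends to b, which
    absorbs y & x. *)
Lemma tnC x y : 0 <= x <= 1 -> 0 <= y <= 1 -> tn x y = tn y x.
Proof.
wlog xy : x y / x <= y.
  by move=> H Ix Iy; case: (leP x y) => [/H|/ltW/H->] //; apply.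
move=> Ix Iy; have I1 := itv1; have [x0 x1] := andP Ix.
pose A := [set z | 0 <= z <= 1 /\ forall n, x <= tn_exp z n].
pose b := inf01 A.
have A0 z : A z -> 0 <= z by case=> /andP[].
have Ib : 0 <= b <= 1 by exact: inf01_itv.
have xb : x <= b.
  by apply: le_inf01 => // z [Iz /(_ 1%N)]; rewrite /= tnx1.
have bb : tn b b = b.
  apply/eqP; rewrite eq_le tn_lel //= leNgt; apply/negP => bbb.
  have [d d0 H] := tn_lt_near Ib Ib bbb.
  have b1 : b < 1.
    rewrite lt_neqAle (andP Ib).2 andbT; apply: contraTneq bbb => ->.
    by rewrite tn1x // ltxx.
  have [||z Az zd] := @inf01_lt _ A (Num.min 1 (b + d)).
  - by rewrite ge_min lexx.
  - by rewrite lt_min b1 /=; lra.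
  have [_ {}zd] : z < 1 /\ z < b + d by apply/andP; rewrite -lt_min.
  have [Iz Ez] := Az.
  have : b <= tn z z.
    apply: inf01_le => //; split=> [|n]; first exact: tn_itv.
    by rewrite tn_exp_square.
  by rewrite leNgt H.
have [yb|bley] := ltP y b; last first.
  have [xbl xbr] := tn_idem_absorb Ib bb x0 xb.
  have xyl : tn x y = x.
    apply/eqP; rewrite eq_le tn_lel //= -[leLHS]xbr.
    by apply: le_tn.
  rewrite xyl; apply/eqP; rewrite eq_le tn_ler // andbT -[leLHS]xbl.
  by apply: le_tn.
have key u v : 0 <= u <= 1 -> 0 <= v <= 1 -> x <= u -> x <= v -> v <= y ->
    tn v u <= tn u v.
  move=> Iu Iv xu xv vy; rewrite leNgt; apply/negP => lt_uv.
  have Ivu := tn_itv Iv Iu; have [vu0 vu1] := andP Ivu.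
  have vub : tn v u <= b.
    by apply: le_trans (tn_lel Iv Iu) (le_trans vy (ltW yb)).
  have lt_b : tn u v < tn (tn b b) (tn v u).
    by rewrite bb (tn_idem_absorb Ib bb vu0 vub).1.
  have Ibb := tn_itv Ib Ib.
  have [d d0 H] := tn_gt_near Ibb Ivu lt_b.
  have [|d' d'0 H'] := @tn_gt_near b b (tn b b - d) Ib Ib; first by lra.
  have [z [yz zb zd]] : exists z, [/\ y < z, z < b & b - d' < z].
    move: (b) yb => c yc; exists (Num.max ((y + c) / 2) (c - d' / 2)).
    by case: (leP ((y + c) / 2)) => ?; split; lra.
  have [b0 b1] := andP Ib; have [y0 y1] := andP Iy.
  have Iz : 0 <= z <= 1 by apply/andP; split; lra.
  have [n zn] : exists n, tn_exp z n < x.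
    apply: contrapT => nex; have : b <= z; last by rewrite leNgt zb.
    apply: inf01_le => //; split => // n.
    by rewrite leNgt; apply/negP => zn; apply: nex; exists n.
  have := tn_square_swap Iz Iu Iv (lt_le_trans zn xu) (lt_le_trans zn xv).
  rewrite leNgt H //; [exact: tn_itv|exact: H'|lra].
by apply/eqP; rewrite eq_le !key.
Qed.

(** The form in which continuity at (1, c) is used throughout: to bound c it is
    enough to bound t & c for every t < 1. *)
Lemma le_tn_left1 c d : 0 <= c <= 1 ->
  (forall t, 0 <= t <= 1 -> t < 1 -> tn t c <= d) -> c <= d.
Proof.
move=> Ic H; rewrite leNgt; apply/negP => dc.
have I1 := itv1; have : d < tn 1 c by rewrite tn1x.
case/(tn_gt_near I1 Ic) => e e0 He.
have [t [t0 t1 et]] : exists t, [/\ 0 <= t, t < 1 & 1 - e < t].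
  by exists (Num.max 0 (1 - e / 2)); case: (leP 0 (1 - e / 2)) => ?; split; lra.
have It : 0 <= t <= 1 by rewrite t0 ltW.
have := H t It t1; rewrite leNgt He //; lra.
Qed.

Lemma le_tn_inf01 a (A : set R) s : 0 <= a <= 1 ->
  (forall v, A v -> 0 <= v <= 1) -> s <= a ->
  (forall v, A v -> s <= tn a v) -> s <= tn a (inf01 A).
Proof.
move=> Ia AI sa H; rewrite leNgt; apply/negP.
have II : 0 <= inf01 A <= 1 by apply: inf01_itv => v /AI /andP[].
case/(tn_lt_near Ia II) => e e0 He.
have [lt1|le1] := ltP (inf01 A + e) 1.
  have [||v Av ve] := @inf01_lt _ A (inf01 A + e); [lra|lra|].
  have := H _ Av; rewrite leNgt He //; [exact: AI|lra].
have /andP[A0 A1] := II.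
have [eq1|ne1] := leP 1 (inf01 A).
  have I1 := itv1.
  have : tn a 1 < s by apply: He => //; lra.
  by rewrite tnx1 // ltNge sa.
have [||v Av ve] := @inf01_lt _ A 1 => //.
have := H _ Av; rewrite leNgt He //; [exact: AI|lra|lra].
Qed.

Lemma tn_sup01_le a (A : set R) d : 0 <= a <= 1 ->
  (forall v, A v -> 0 <= v <= 1) -> 0 <= d ->
  (forall v, A v -> tn a v <= d) -> tn a (sup01 A) <= d.
Proof.
move=> Ia AI d0 H; rewrite leNgt; apply/negP => dlt.
have IS : 0 <= sup01 A <= 1 by apply: sup01_itv => v /AI /andP[].
have S0 : 0 < sup01 A by apply: le_lt_trans d0 (lt_le_trans dlt (tn_ler Ia IS)).
have [e e0 He] := tn_gt_near Ia IS dlt.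
have [||v Av ve] := @lt_sup01 _ A (Num.max 0 (sup01 A - e)).
- by rewrite le_max lexx.
- by rewrite gt_max S0 /=; lra.
have {ve} [_ ve] : 0 < v /\ sup01 A - e < v by apply/andP; rewrite -gt_max.
by have := H _ Av; rewrite leNgt He //; [exact: AI|lra].
Qed.

(** The adjunction between x & - and x -> -; it amounts to [tn_sup01_le], the
    preservation of suprema by x & -. *)
Lemma le_implication u x z : 0 <= u <= 1 -> 0 <= x <= 1 -> 0 <= z <= 1 ->
  (u <= implication tn x z) = (tn x u <= z).
Proof.
move=> Iu Ix Iz; apply/idP/idP => [uxz|xuz]; last first.
  by apply: le_sup01 => [y [/andP[]]|].
apply: (@le_trans _ _ (tn x (implication tn x z))).
  by apply: le_tn => //; itv.
by apply: tn_sup01_le => // [v []||v []] //; case/andP: Iz.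
Qed.

Lemma le_sub_hom (X : Type) (f g : X -> R) u : 0 <= u <= 1 ->
  (forall x, 0 <= f x <= 1) -> (forall x, 0 <= g x <= 1) ->
  u <= sub_hom tn f g <-> forall x, tn (f x) u <= g x.
Proof.
move=> Iu If Ig; split=> [uH x|H].
  rewrite -le_implication //; apply: le_trans uH _.
  by apply: inf01_le => [_ [y _ <-]|]; [exact: implication_ge0|exists x].
apply: le_inf01 => [|_ [x _ <-]]; first by case/andP: Iu.
by rewrite le_implication.
Qed.

Lemma tn_sub_hom (X : Type) (f g : X -> R) x :
  (forall x, 0 <= f x <= 1) -> (forall x, 0 <= g x <= 1) ->
  tn (f x) (sub_hom tn f g) <= g x.
Proof.
by move=> If Ig; have [+ _] := le_sub_hom (sub_hom_itv tn f g) If Ig; apply.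
Qed.

Lemma sub_hom_eq1 (X : Type) (f g : X -> R) :
  (forall x, 0 <= f x <= 1) -> (forall x, 0 <= g x <= 1) ->
  sub_hom tn f g = 1 <-> forall x, f x <= g x.
Proof.
move=> If Ig; have [H1 H2] := le_sub_hom itv1 If Ig; split=> [E x|H].
  by rewrite -[leLHS]tnx1 //; apply: H1; rewrite E.
apply/eqP; rewrite eq_le (andP (sub_hom_itv tn f g)).2; apply: H2 => x.
by rewrite tnx1.
Qed.

(** * Weighted joins and ideals *)

Lemma bigmax_itv (D : finType) (G : D -> R) :
  (forall d, 0 <= G d <= 1) -> 0 <= \big[Num.max/0]_d G d <= 1.
Proof.
move=> IG; rewrite bigmax_ge_id /= bigmax_le // => d _.
by case/andP: (IG d).
Qed.

Lemma tn_bigmax_le (D : finType) (G : D -> R) a m :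
  0 <= a <= 1 -> (forall d, 0 <= G d <= 1) -> 0 <= m ->
  (tn (\big[Num.max/0]_d G d) a <= m) <-> (forall d, tn (G d) a <= m).
Proof.
move=> Ia IG m0; have IM := bigmax_itv IG; have I0 := itv0.
split=> [H d|H].
  by apply: le_trans H; apply: le_tn => //; exact: le_bigmax.
have /bigmax_geP[le0|[d _ led]] := lexx (\big[Num.max/0]_d G d).
  apply: le_trans m0; apply: le_trans (tn_lel I0 Ia).
  exact: le_tn.
by apply: le_trans (H d); exact: le_tn.
Qed.

(** The value of the finite weighted colimit, both in [0,1] and, pointwise, in
    the category of weights. *)
Definition weighted_join (D : finType) (W G : D -> R) : R :=
  \big[Num.max/0]_d tn (W d) (G d).

Lemma weighted_join_itv (D : finType) (W G : D -> R) :
  (forall d, 0 <= W d <= 1) -> (forall d, 0 <= G d <= 1) ->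
  0 <= weighted_join W G <= 1.
Proof. by move=> IW IG; apply: bigmax_itv => d; itv. Qed.

(** A functor category whose homs are computed pointwise has its colimits
    computed pointwise as soon as the pointwise weighted join j exists in it.
    Taking T = X gives the category of weights, a singleton T gives [0,1]. *)
Lemma is_colimit_pointwise (T C : Type) (hC : C -> C -> R) (v : C -> T -> R)
    (D : finType) (W : D -> R) (F : D -> C) (c j : C) :
  (forall a b, hC a b = sub_hom tn (v a) (v b)) ->
  (forall a x, 0 <= v a x <= 1) -> (forall d, 0 <= W d <= 1) ->
  (forall x, v j x = weighted_join W (fun d => v (F d) x)) ->
  is_colimit tn hC W F c <->
  forall x, v c x = weighted_join W (fun d => v (F d) x).
Proof.
move=> hCE Iv IW vj.
have cocone u y : 0 <= u <= 1 -> u <= sub_hom tn W (fun d => hC (F d) y) <->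
    forall x, tn (weighted_join W (fun d => v (F d) x)) u <= v y x.
  move=> Iu; have Ih d : 0 <= hC (F d) y <= 1 by rewrite hCE sub_hom_itv.
  have E : (forall d, tn (W d) u <= hC (F d) y) <->
      forall x d, tn (tn (W d) (v (F d) x)) u <= v y x.
    have Ed d : (tn (W d) u <= hC (F d) y) <->
        (forall x, tn (tn (W d) (v (F d) x)) u <= v y x).
      rewrite hCE le_sub_hom //; last by itv.
      have Ex x : tn (v (F d) x) (tn (W d) u) = tn (tn (W d) (v (F d) x)) u.
        by rewrite tnA // (tnC (Iv (F d) x) (IW d)).
      by split=> H x; have := H x; rewrite Ex.
    by split=> [H x d|H d]; [exact: (Ed d).1 (H d) x|apply/Ed => x; exact: H].
  rewrite le_sub_hom // E.
  by split=> H x; have := H x; rewrite tn_bigmax_le //;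
    [move=> d; itv|case/andP: (Iv y x)|move=> d; itv|case/andP: (Iv y x)].
have Ij x := Iv j x.
split=> [cE x|cE y].
  apply/eqP; rewrite eq_le; apply/andP; split.
    rewrite -vj; move: x; apply/(@sub_hom_eq1 _ (v c) (v j)) => //.
    rewrite -hCE cE; apply/eqP; rewrite eq_le (andP (sub_hom_itv _ _ _)).2.
    by apply/(cocone _ _ itv1) => x; rewrite -vj tnx1.
  rewrite -[leLHS]tnx1 -?vj //; move: x.
  have := cocone 1 c itv1; rewrite -cE hCE => H x.
  rewrite vj; move: x; apply/H; rewrite le_sub_hom //; last exact: itv1.
  by move=> x; rewrite tnx1.
have Ic : forall x, 0 <= v c x <= 1 by [].
apply/eqP; rewrite eq_le hCE; apply/andP; split.
  apply/cocone; first exact: sub_hom_itv.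
  by move=> x; rewrite -cE; exact: tn_sub_hom.
apply/le_sub_hom => // [|x]; first exact: sub_hom_itv.
by rewrite cE; move: x; apply/cocone; rewrite // sub_hom_itv.
Qed.

Lemma weighted_join_weight (X : Type) (h : X -> X -> R) (D : finType)
    (W : D -> R) (F : D -> weights tn h) :
  (forall x y, 0 <= h x y <= 1) -> (forall d, 0 <= W d <= 1) ->
  weight tn h (fun x => weighted_join W (fun d => sval (F d) x)).
Proof.
move=> Ih IW; have IF d x : 0 <= sval (F d) x <= 1 by exact: (svalP (F d)).1.
split=> [x|x y]; first exact: weighted_join_itv.
apply/tn_bigmax_le => // [d||d]; first by itv.
  by case/andP: (weighted_join_itv IW (IF^~ x)).
rewrite -tnA //; apply: le_trans (le_bigmax _ _ d).
by apply: le_tn => //; [itv|exact: (svalP (F d)).2].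
Qed.

Lemma is_colimit_weights (X : Type) (h : X -> X -> R) (D : finType)
    (W : D -> R) (F : D -> weights tn h) (c : weights tn h) :
  (forall x y, 0 <= h x y <= 1) -> (forall d, 0 <= W d <= 1) ->
  is_colimit tn (@weights_hom R tn X h) W F c <->
  forall x, sval c x = weighted_join W (fun d => sval (F d) x).
Proof.
move=> Ih IW.
apply: (@is_colimit_pointwise _ _ _ (fun a : weights tn h => sval a) _ W F c
  (exist _ _ (weighted_join_weight F Ih IW))) => //.
by move=> a; exact: (svalP a).1.
Qed.

Lemma is_colimit_unit_interval (D : finType) (W : D -> R)
    (G : D -> unit_interval R) (c : unit_interval R) :
  (forall d, 0 <= W d <= 1) ->
  is_colimit tn (unit_interval_hom tn) W G c <->
  sval c = weighted_join W (fun d => sval (G d)).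
Proof.
move=> IW; have Iv (a : unit_interval R) (x : unit) : 0 <= sval a <= 1.
  exact: svalP a.
rewrite (@is_colimit_pointwise unit _ _ (fun a _ => sval a) _ W G c
  (exist (fun r : R => is_true (0 <= r <= 1)) _
    (weighted_join_itv IW (fun d => svalP (G d))))) //.
  by split=> // H; exact: H tt.
move=> a b; have Ia := Iv a tt; have Ib := Iv b tt.
have IS := sub_hom_itv tn (fun _ : unit => sval a) (fun=> sval b).
rewrite /unit_interval_hom; apply/eqP; rewrite eq_le; apply/andP; split.
  apply/le_sub_hom => //; try itv.
  by move=> _ /=; rewrite -le_implication //; itv.
rewrite le_implication //.
exact: (@tn_sub_hom unit (fun=> sval a) (fun=> sval b) tt).
Qed.

(** Of the two inequalities that express preservation of a weighted join, the
    comparison from the join of the images always holds, so being an ideal is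
    the opposite one.  A weight on a finite set is a weight on the discrete
    category over it, which is why the indexing category disappears. *)
Lemma idealP (X : Type) (h : X -> X -> R) (phi : X -> R) :
  (forall x y, 0 <= h x y <= 1) -> weight tn h phi ->
  ideal tn h phi <->
  forall (D : finType) (W : D -> R) (F : D -> weights tn h) (c : weights tn h),
    (forall d, 0 <= W d <= 1) ->
    (forall x, sval c x = weighted_join W (fun d => sval (F d) x)) ->
    sub_hom tn phi (sval c) <=
    weighted_join W (fun d => sub_hom tn phi (sval (F d))).
Proof.
move=> Ih wphi; have Iphi := wphi.1.
have Iw (c : weights tn h) x : 0 <= sval c x <= 1 by exact: (svalP c).1.
have IS (c : weights tn h) := sub_hom_itv tn phi (sval c).
split=> [[_ idphi] D W F c IW cE|H].
  pose hD (d e : D) : R := (d == e)%:R.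
  have IhD d e : 0 <= hD d e <= 1.
    by rewrite /hD; case: eqP; rewrite ?lexx ler01.
  have tn0 x z : 0 <= x <= 1 -> 0 <= z <= 1 -> tn x 0 <= z /\ tn 0 x <= z.
    move=> Ix /andP[z0 _]; have I0 := itv0.
    by split; apply: le_trans z0; [exact: tn_ler|exact: tn_lel].
  have rD : real_enriched tn hD.
    split=> // [x|x y z]; first by rewrite /hD eqxx.
    rewrite {2}/hD; case: eqP => [->|_]; first by rewrite tnx1.
    exact: (tn0 _ _ _ _).1.
  have wW : weight tn hD W.
    split=> // x y; rewrite /hD; case: eqP => [->|_]; first by rewrite tnx1.
    exact: (tn0 _ _ _ _).1.
  have fF : enriched_functor hD (@weights_hom R tn X h) F.
    move=> x y; rewrite /hD; case: eqP => [->|_]; last first.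
      by case/andP: (sub_hom_itv tn (sval (F x)) (sval (F y))).
    by rewrite /weights_hom (sub_hom_eq1 (Iw _) (Iw _)).2.
  have /is_colimit_weights cc := cE.
  have := idphi D hD W F c rD wW fF (cc Ih IW).
  by move/is_colimit_unit_interval => /(_ IW) /= ->.
split=> // D hD W F c _ [IW _] _ /is_colimit_weights cE.
apply/is_colimit_unit_interval => //=.
have {}cE := cE Ih IW; apply/eqP; rewrite eq_le H //=.
apply/bigmax_leP; split=> [|d _]; first by case/andP: (IS c).
apply/le_sub_hom => // [|x]; first by itv.
rewrite cE; apply: le_trans (le_bigmax _ _ d).
rewrite tnA // (tnC (Iphi x) (IW d)) -tnA //.
by apply: le_tn => //; [itv|exact: tn_sub_hom].
Qed.
End Tnorm.

Local Ltac itv := solve [repeat first [assumption | exact: itv0 | exact: itv1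
  | apply: tn_itv | apply: implication_itv | apply: sub_hom_itv | trivial]].

(** * Convergence for the symmetrization and bilimits *)

Section Convergence.
Variables (R : realType) (tn : R -> R -> R) (htn : continuous_tnorm tn).

Lemma lt_tn_near1 c r : 0 <= c <= 1 -> r < c ->
  exists t, [/\ 0 <= t <= 1, t < 1 & r < tn t c].
Proof.
move=> Ic rc; apply: contrapT => H; move: rc; apply/negP; rewrite -leNgt.
apply: (le_tn_left1 htn Ic) => t It t1; rewrite leNgt; apply/negP => rt.
by apply: H; exists t.
Qed.

Lemma real_enriched_op (X : Type) (h : X -> X -> R) :
  real_enriched tn h -> real_enriched tn (fun x y => h y x).
Proof. by case=> Ih h1 hT; split=> // x y z; rewrite (tnC htn). Qed.

Lemma real_enriched_symmetrization (X : Type) (h : X -> X -> R) :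
  real_enriched tn h -> real_enriched tn (symmetrization h).
Proof.
move=> hX; have [Ih h1 hT] := hX; have [_ _ hT'] := real_enriched_op hX.
have IS x y : 0 <= symmetrization h x y <= 1 by exact: min_itv.
split=> // [x|x y z]; first by rewrite /symmetrization h1 minxx.
rewrite [leRHS]/symmetrization le_min; apply/andP; split.
  by apply: le_trans (hT x y z); apply: (le_tn htn) => //; rewrite ge_min lexx.
apply: le_trans (hT' x y z).
by apply: (le_tn htn) => //; rewrite ge_min lexx orbT.
Qed.

Section Net.
Variables (X : Type) (h : X -> X -> R).
Hypothesis hX : real_enriched tn h.
Variables (D : directed_set) (x : D -> X).

(** A ball B(y, r) around a contains the x_j with S(a, x_j) close to 1, where S
    is the symmetrized hom, because S(y, x_j) >= S(a, x_j) & S(y, a) > r. *)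
Lemma sym_convergesP a : sym_converges h x a <->
  (forall t, t < 1 -> tails D [set j | t <= h a (x j)]) /\
  (forall t, t < 1 -> tails D [set j | t <= h (x j) a]).
Proof.
have [IS S1 ST] := real_enriched_symmetrization hX.
split=> [cv|[H1 H2] S U].
  have H t : t < 1 -> tails D [set j | t < symmetrization h a (x j)].
    move=> t1; apply: (cv (open_ball (symmetrization h) a t)).
    rewrite nbhsE; exists (open_ball (symmetrization h) a t) => //.
    split; last by rewrite /open_ball /= S1.
    exists [set open_ball (symmetrization h) a t]; last by rewrite bigcup_set1.
    move=> _ ->.
    exists [fset (open_ball (symmetrization h) a t : set X)]%fset; last first.
      by rewrite set_fset1 bigcap_set1.
    by move=> B; rewrite !inE => /eqP ->; apply/mem_set; exists a, t.
  by split=> t /H; apply: tailsS => j /=; rewrite lt_min => /andP[/ltW + /ltW].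
rewrite nbhsE => -[_ [[G GF <-] [B GB Ba]] BU].
have [F FB EB] := GF B GB.
have : (x @ tails D) (\bigcap_(i in [set` F]) i).
  apply: (@filter_bigI _ _ F id) => C CF.
  have /set_mem[y [r [r1 EC]]] := FB _ CF.
  have : C a by move: Ba; rewrite -EB; apply.
  rewrite EC /open_ball /= => /(lt_tn_near1 (IS y a))[t [It t1 rt]].
  apply: tailsS (tailsI (H1 _ t1) (H2 _ t1)) => j [tj1 tj2] /=.
  apply: (lt_le_trans rt); apply: le_trans (ST y a (x j)).
  by apply: (le_tn htn) => //; rewrite le_min tj1.
by rewrite EB; apply: filterS => y By; apply: BU; exists B.
Qed.

(** Half of the bilimit condition; applied to the opposite category it yields
    the other half. *)
Lemma net_liminf_hom a :
  (forall t, t < 1 -> tails D [set j | t <= h a (x j)]) ->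
  (forall t, t < 1 -> tails D [set j | t <= h (x j) a]) ->
  forall y, net_liminf (fun j => h y (x j)) = h y a.
Proof.
have [Ih h1 hT] := hX.
move=> H1 H2 y; apply/eqP; rewrite eq_le; apply/andP; split.
  apply: net_liminf_le => // [|r Ir Hr]; first by case/andP: (Ih y a).
  apply: (le_tn_left1 htn Ir) => t It t1.
  have [j [tj rj]] := tails_nonempty (tailsI (H2 t t1) Hr).
  by apply: le_trans (hT y (x j) a); exact: (le_tn htn).
apply: le_net_liminf => // [|r ry]; first by case/andP: (Ih y a).
have [t [It t1 rt]] := lt_tn_near1 (Ih y a) ry.
apply: tailsS (H1 t t1) => j /= tj.
apply: le_trans (ltW rt) (le_trans _ (hT y a (x j))).
exact: (le_tn htn).
Qed.

End Net.

Section Bilimits.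
Variables (X : Type) (h : X -> X -> R) (hX : real_enriched tn h).

(** Conversely to [net_liminf_hom], testing the bilimit condition on a itself
    shows that X(a, x_j) and X(x_j, a) tend to X(a, a) = 1. *)
Lemma sym_converges_bilimit (D : directed_set) (x : D -> X) a :
  sym_converges h x a <-> bilimit h x a.
Proof.
have [Ih h1 hT] := hX; rewrite (sym_convergesP hX); split=> [[H1 H2] y|H].
  split; first exact: (net_liminf_hom hX).
  exact: (net_liminf_hom (real_enriched_op hX)).
have [Ha Ha'] := H a; split=> t t1.
  by apply: tails_net_liminf => //; rewrite Ha h1.
by apply: tails_net_liminf => //; rewrite Ha' h1.
Qed.

Lemma bilimit_unique (D : directed_set) (x : D -> X) a b :
  separated_cat h -> bilimit h x a -> bilimit h x b -> a = b.
Proof.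
have [Ih h1 hT] := hX; move=> sep Ha Hb.
have E y : h y a = h y b by rewrite -(Ha y).1 (Hb y).1.
by apply: sep; rewrite ?E ?h1 // -E h1.
Qed.

Definition unit_directed : directed_set.
Proof.
by refine (@DirectedSet unit (fun _ _ => True) _ _ (inhabits tt) _) => // _ _;
  exists tt.
Defined.

(** If X(a, b) = X(b, a) = 1 then both points are bilimits of the constant
    net a. *)
Lemma bilimits_unique_separated :
  (forall (D : directed_set) (x : D -> X),
     forward_cauchy h x -> exists! a, bilimit h x a) -> separated_cat h.
Proof.
have [Ih h1 hT] := hX; move=> H a b hab hba.
pose x (i : unit_directed) := a.
have [|c [_ Hc]] := H _ x.
  apply/forward_cauchyP => // t t1; exists tt => j k _ _.
  by rewrite /x h1 ltW.
have lim e : h a e = 1 -> h e a = 1 -> bilimit h x e.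
  move=> hae hea; apply/sym_converges_bilimit/(sym_convergesP hX).
  by split=> t t1; exists tt => j _ /=; rewrite /x ?hae ?hea ltW.
by transitivity c; [apply/esym|]; apply: Hc; apply: lim.
Qed.

Lemma bilimit_yoneda_limit (D : directed_set) (x : D -> X) a :
  bilimit h x a -> yoneda_limit h x a.
Proof. by move=> H y; have [] := H y. Qed.

Lemma yoneda_limit_unique (D : directed_set) (x : D -> X) a b :
  separated_cat h -> yoneda_limit h x a -> yoneda_limit h x b -> a = b.
Proof.
have [Ih h1 hT] := hX; move=> sep Ha Hb.
have E y : h a y = h b y by rewrite -Ha Hb.
by apply: sep; rewrite ?E ?h1 // -E h1.
Qed.

Definition net_weight (D : directed_set) (x : D -> X) (y : X) : R :=
  net_liminf (fun j => h y (x j)).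

Lemma net_weight_weight (D : directed_set) (x : D -> X) :
  weight tn h (net_weight x).
Proof.
have [Ih h1 hT] := hX.
split=> [y|y z]; first by apply: net_liminf_itv.
have In w : 0 <= net_weight x w <= 1 by exact: net_liminf_itv.
rewrite (tnC htn) // -(le_implication htn) //.
have [I0 I1] := andP (implication_itv tn (h y z) (net_weight x y)).
apply: net_liminf_le => // r Ir Hr; rewrite (le_implication htn) //.
apply: le_net_liminf => // [|s sr].
  by case/andP: (tn_itv htn (Ih y z) Ir).
apply: tailsS Hr => j /= rj; apply: le_trans (ltW sr) _.
rewrite (tnC htn) //; apply: le_trans (hT y z (x j)).
exact: (le_tn htn).
Qed.

(** Along a forward Cauchy net X(x_i, x_j) >= t for all large i <= j; let j
    grow. *)
Lemma net_weight_near1 (D : directed_set) (x : D -> X) :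
  forward_cauchy h x -> forall t, t < 1 ->
  tails D [set j | t <= net_weight x (x j)].
Proof.
have [Ih h1 hT] := hX; move=> /(forward_cauchyP _ Ih) xC t t1.
have [i Hi] := xC t t1; exists i => j ij; apply: le_net_liminf => //.
  exact: ltW.
by move=> r rt; exists j => k jk; apply: le_trans (ltW rt) _; exact: Hi.
Qed.

Lemma representing_bilimit (D : directed_set) (x : D -> X) a :
  forward_cauchy h x -> (forall y, net_weight x y = h y a) -> bilimit h x a.
Proof.
have [Ih h1 hT] := hX; move=> xC E.
apply/sym_converges_bilimit/(sym_convergesP hX); split=> t t1.
  by apply: tails_net_liminf => //; rewrite -/(net_weight x a) E h1.
by apply: tailsS (net_weight_near1 xC t1) => j; rewrite /= E.
Qed.

End Bilimits.
End Convergence.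

(** * Ideals and forward Cauchy nets *)

Section Ideals.
Variables (R : realType) (tn : R -> R -> R) (htn : continuous_tnorm tn).
Variables (X : Type) (h : X -> X -> R) (hX : real_enriched tn h).

Lemma const1_weight : weight tn h (fun=> 1).
Proof.
have [Ih _ _] := hX; split=> [_|x y]; first exact: itv1.
by rewrite (tn1x htn) //; case/andP: (Ih x y).
Qed.

Lemma residual_weight a r : 0 <= r <= 1 ->
  weight tn h (fun z => implication tn (h a z) r).
Proof.
have [Ih _ hT] := hX; move=> Ir.
have II z := implication_itv tn (h a z) r; split=> // w z.
have Iz := tn_itv htn (II z) (Ih w z).
rewrite (le_implication htn) // (tnC htn (II z)) // (tnA htn) //.
rewrite (tnC htn (Ih a w)) //.
apply: (@le_trans _ _ (tn (h a z) (implication tn (h a z) r))).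
  by apply: (le_tn htn) => //; exact: (tn_itv htn).
by rewrite -(le_implication htn).
Qed.

(** If no z were as required, every z would satisfy phi(z) <= t or
    X(x_d, z) <= r_d for some d, that is, phi would lie below the finite join of
    t & 1 and the weights X(x_d, -) -> r_d.  As phi is an ideal, t & sub(phi, 1)
    or some sub(phi, X(x_d, -) -> r_d) equals 1; the first is at most t < 1, and
    the second gives phi(x_d) <= r_d at the point x_d. *)
Lemma ideal_directed phi (D : finType) (x : D -> X) (r : D -> R) t :
  ideal tn h phi -> (forall d, 0 <= r d < phi (x d)) -> 0 <= t < 1 ->
  exists z, t < phi z /\ forall d, r d < h (x d) z.
Proof.
move=> idphi rphi /andP[t0 t1]; have [wphi _] := idphi; have Iphi := wphi.1.
have [Ih h1 hT] := hX; have It : 0 <= t <= 1 by rewrite t0 ltW.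
have Ir d : 0 <= r d <= 1.
  have /andP[-> /ltW rd] := rphi d; apply: le_trans rd _.
  by case/andP: (Iphi (x d)).
pose W (o : option D) : R := if o is Some _ then 1 else t.
pose F (o : option D) : weights tn h := if o is Some d
  then exist _ _ (residual_weight (x d) (Ir d)) else exist _ _ const1_weight.
have IW o : 0 <= W o <= 1 by case: o => [d|] //; exact: itv1.
have IF o y : 0 <= sval (F o) y <= 1 by exact: (svalP (F o)).1.
pose c : weights tn h := exist _ _ (weighted_join_weight htn F Ih IW).
have Ic y : 0 <= sval c y <= 1 by exact: (svalP c).1.
apply: contrapT => nz.
have /bigmax_geP :
    1 <= weighted_join tn W (fun o => sub_hom tn phi (sval (F o))).
  rewrite -[leLHS](_ : sub_hom tn phi (sval c) = 1).
    exact: ((idealP htn Ih wphi).1 idphi).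
  apply/(sub_hom_eq1 htn) => // z; have /andP[_ phi1] := Iphi z.
  have [le_t|lt_t] := leP (phi z) t.
    apply: (le_trans le_t); apply: (bigmax_sup None) => //=.
    by rewrite (tnx1 htn).
  have [d rd] : exists d, h (x d) z <= r d.
    apply: contrapT => nd; apply: nz; exists z; split=> // d.
    by rewrite ltNge; apply/negP => rd; apply: nd; exists d.
  apply: (le_trans phi1); apply: (bigmax_sup (Some d)) => //=.
  rewrite (tn1x htn); last exact: implication_itv.
  by rewrite (le_implication htn (itv1 R)) // (tnx1 htn).
case=> [|[[d|] _ /=]]; first by rewrite ler10.
  rewrite (tn1x htn); last exact: sub_hom_itv.
  move/(le_sub_hom htn (itv1 R) Iphi (fun y => implication_itv tn _ _)).
  move/(_ (x d)); rewrite h1 (tnx1 htn) // (le_implication htn) ?itv1 //.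
  by rewrite (tn1x htn) // leNgt; have /andP[_ ->] := rphi d.
move/le_trans/(_ (tn_lel htn It (sub_hom_itv _ _ _))).
by rewrite leNgt t1.
Qed.

Definition ideal_elements (phi : X -> R) : Type :=
  {p : X * R | 0 <= p.2 < phi p.1}.

(** The factor s makes this relation transitive, which X(x, y) >= r alone need
    not be. *)
Definition ideal_le (phi : X -> R) (p q : ideal_elements phi) : Prop :=
  (sval p).2 <= tn (sval q).2 (h (sval p).1 (sval q).1).

Section IdealNet.
Variables (phi : X -> R) (idphi : ideal tn h phi).

Let Iphi x : 0 <= phi x <= 1. Proof. exact: idphi.1.1. Qed.

Lemma ideal_elements_itv (p : ideal_elements phi) : 0 <= (sval p).2 <= 1.
Proof.
case: p => -[x r] /= /andP[-> /ltW rx]; apply: le_trans rx _.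
by case/andP: (Iphi x).
Qed.
Let Ie := ideal_elements_itv.

Lemma ideal_le_refl (p : ideal_elements phi) : ideal_le p p.
Proof. by have [_ h1 _] := hX; rewrite /ideal_le h1 (tnx1 htn). Qed.

Lemma ideal_le_trans (p q s : ideal_elements phi) :
  ideal_le p q -> ideal_le q s -> ideal_le p s.
Proof.
have [Ih _ hT] := hX; rewrite /ideal_le => pq qs.
apply: le_trans pq _.
apply: (@le_trans _ _ (tn (tn (sval s).2 (h (sval q).1 (sval s).1))
                          (h (sval p).1 (sval q).1))).
  by apply: (le_tn htn) => //; exact: (tn_itv htn).
by rewrite -(tnA htn) //; apply: (le_tn htn) => //; exact: (tn_itv htn).
Qed.

Lemma ideal_elements_above t : 0 <= t < 1 ->
  exists q : ideal_elements phi, (sval q).2 = t.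
Proof.
move=> t01; pose x (v : void) : X := match v with end.
have [|//|z [tz _]] := @ideal_directed phi void x (fun=> 0) t idphi.
  by case.
have tz' : 0 <= (z, t).2 < phi (z, t).1 by rewrite /= tz andbT; case/andP: t01.
by exists (exist _ (z, t) tz').
Qed.

(** The gap between r and phi(x) leaves room for a factor close to 1: with m
    halfway between them there is u < 1 with r < u & m, and [ideal_directed]
    provides a common z with X(x, z) > m and phi(z) above u and t. *)
Lemma ideal_le_directed (p q : ideal_elements phi) t : t < 1 ->
  exists s, [/\ ideal_le p s, ideal_le q s & t <= (sval s).2].
Proof.
have [Ih _ hT] := hX; move=> t1.
pose y (b : bool) := if b then p else q.
pose m b := ((sval (y b)).2 + phi (sval (y b)).1) / 2.
have ym b : 0 <= (sval (y b)).2 < phi (sval (y b)).1 by exact: svalP (y b).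
have [ym1 ym2] : (forall b, (sval (y b)).2 < m b) /\
    forall b, m b < phi (sval (y b)).1.
  by split=> b; have /andP[_ ?] := ym b; rewrite /m; lra.
have m0 b : 0 <= m b by have /andP[y0 _] := ym b; rewrite (le_trans y0) ?ltW.
have Im b : 0 <= m b <= 1.
  by rewrite m0 (le_trans (ltW (ym2 b))) //; case/andP: (Iphi (sval (y b)).1).
have /choice[u Hu] b : exists u,
    [/\ 0 <= u <= 1, u < 1 & (sval (y b)).2 < tn u (m b)].
  exact: (lt_tn_near1 htn (Im b)).
pose w := Num.max (Num.max t (u true)) (u false).
have [Iut ut1 _] := Hu true; have [Iuf uf1 _] := Hu false.
have w1 : w < 1 by rewrite !gt_max t1 ut1 uf1.
have w0 : 0 <= w by rewrite !le_max (andP Iut).1 orbT.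
have Iw : 0 <= w <= 1 by rewrite w0 ltW.
have uw b : u b <= w by case: b; rewrite !le_max lexx ?orbT.
have [b||z [wz hz]] :=
  @ideal_directed phi bool (fun b => (sval (y b)).1) m w idphi.
- by rewrite m0 ym2.
- by rewrite w0 w1.
have wz' : 0 <= (z, w).2 < phi (z, w).1 by rewrite /= w0.
have le_s b : ideal_le (y b) (exist _ (z, w) wz').
  have [Iu _ lt_u] := Hu b; rewrite /ideal_le /=.
  by apply: le_trans (ltW lt_u) _; apply: (le_tn htn) => //; exact: ltW.
exists (exist _ (z, w) wz'); split; [exact: (le_s true)|exact: (le_s false)|].
by rewrite /= !le_max lexx.
Qed.

Definition ideal_directed_set : directed_set.
Proof.
refine (@DirectedSet (ideal_elements phi) (@ideal_le phi) ideal_le_refl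
  ideal_le_trans _ _).
  have [|q _] := @ideal_elements_above 0; first by rewrite lexx ltr01.
  exact: (inhabits q).
move=> p q; have [s [ps qs _]] := ideal_le_directed p q (@ltr01 R).
by exists s.
Defined.

Definition ideal_net (p : ideal_directed_set) : X := (sval p).1.

Lemma ideal_net_forward_cauchy : forward_cauchy h ideal_net.
Proof.
have [Ih _ hT] := hX; apply/forward_cauchyP => // t t1.
pose t' := Num.max t 0.
have [|p pt] := @ideal_elements_above t'.
  by rewrite gt_max t1 ltr01 le_max lexx orbT.
exists p => q s pq qs.
apply: (@le_trans _ _ t'); first by rewrite le_max lexx.
rewrite -pt; apply: le_trans pq _.
apply: le_trans (tn_lel htn (Ie q) (Ih _ _)) _.
exact: le_trans qs (tn_ler htn (Ie s) (Ih _ _)).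
Qed.

(** Above (y, r) in the order, X(y, z) >= r, so the liminf is at least phi(y).
    It is at most phi(y) because cofinally phi(z) >= t for every t < 1, and
    phi(z) & X(y, z) <= phi(y). *)
Lemma net_weight_ideal_net y : net_weight h ideal_net y = phi y.
Proof.
have [Ih _ hT] := hX; have [[_ wphi] _] := idphi.
have [phi0 phi1] := andP (Iphi y).
apply/eqP; rewrite eq_le; apply/andP; split.
  apply: net_liminf_le => // r Ir [p Hp].
  apply: (le_tn_left1 htn) => // t It t1.
  have [s [ps _ ts]] := ideal_le_directed p p t1.
  apply: le_trans (wphi y (ideal_net s)); apply: (le_tn htn) => //.
    by apply: le_trans ts _; have /andP[_ /ltW] := svalP s.
  exact: Hp.
apply: le_net_liminf => // r ry; have [r0|r0] := ltP r 0.
  apply: tailsS (tailsT ideal_directed_set) => p _ /=.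
  by apply: le_trans (ltW r0) _; case/andP: (Ih y (ideal_net p)).
have yr : 0 <= (y, r).2 < phi (y, r).1 by rewrite /= r0.
exists (exist _ (y, r) yr) => p yp /=.
exact: le_trans yp (tn_ler htn (Ie p) (Ih _ _)).
Qed.
End IdealNet.

(** Let s = sub(phi, c) for a finite weighted join c.  Since phi(x_j) tends to
    1, c(x_j) >= t1 & s on a tail, and one component d of the join attains this
    cofinally.  Being forward Cauchy turns cofinally into eventually at the cost
    of a factor t2 < 1, and the infimum v of F_d(x_k) over the tail is a lower
    bound of sub(phi, F_d). *)
Lemma net_weight_ideal (D : directed_set) (x : D -> X) :
  forward_cauchy h x -> ideal tn h (net_weight h x).
Proof.
have [Ih _ hT] := hX; move=> xC; set phi := net_weight h x.
have wphi : weight tn h phi by exact: (net_weight_weight htn hX).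
have Iphi := wphi.1; apply/(idealP htn Ih wphi) => E W F c IW cE.
have IF d y : 0 <= sval (F d) y <= 1 by exact: (svalP (F d)).1.
have Ic y : 0 <= sval c y <= 1 by exact: (svalP c).1.
set s := sub_hom tn phi (sval c); set J := weighted_join _ _ _.
have Is : 0 <= s <= 1 by exact: sub_hom_itv.
have IJ : 0 <= J <= 1.
  by apply: (weighted_join_itv htn) => // d; exact: sub_hom_itv.
apply: (le_tn_left1 htn Is) => t1 It1 t11; set u := tn t1 s.
have Iu : 0 <= u <= 1 by exact: (tn_itv htn).
apply: (le_tn_left1 htn Iu) => t2 It2 t21.
have [u0|u0] := leP u 0.
  by apply: le_trans (tn_ler htn It2 Iu) (le_trans u0 _); case/andP: IJ.
have Hc : tails D [set j | exists d, u <= tn (W d) (sval (F d) (x j))].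
  apply: tailsS (net_weight_near1 hX xC t11) => j /= tj.
  have : u <= sval c (x j).
    apply: le_trans (tn_sub_hom htn (x j) Iphi Ic).
    exact: (le_tn htn).
  by rewrite cE => /bigmax_geP[|[d _ ud]]; [rewrite leNgt u0|exists d].
have [d Hd] : exists d, forall A, tails D A ->
    exists2 j, A j & u <= tn (W d) (sval (F d) (x j)).
  apply: contrapT => nd.
  (* Otherwise each component fails on a tail, hence all fail on one tail. *)
  have : tails D [set j | forall d, ~ (u <= tn (W d) (sval (F d) (x j)))].
    pose B d := [set j | ~ (u <= tn (W d) (sval (F d) (x j)))].
    apply: (@filter_forall _ _ B (tails D)) => d.
    apply: contrapT => nt; apply: nd; exists d => A HA.
    apply: contrapT => nj; apply: nt; apply: tailsS HA => j Aj uj.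
    by apply: nj; exists j.
  by move=> H; have [j [[d ud] /(_ d)]] := tails_nonempty (tailsI Hc H).
have [i Hi] := (forward_cauchyP x Ih).1 xC t2 t21.
pose A := [set sval (F d) (x k) | k in [set k | dle i k]].
pose v := inf01 A.
have IA a : A a -> 0 <= a <= 1 by case=> k _ <-.
have Iv : 0 <= v <= 1 by apply: inf01_itv => a /IA /andP[].
have It2u : 0 <= tn t2 u <= 1 by exact: (tn_itv htn).
apply: le_trans (le_bigmax _ _ d).
apply: (@le_trans _ _ (tn (W d) v)).
  apply: (le_tn_inf01 htn) => // [|_ [k ik <-]].
    have [j _ uj] := Hd _ (tailsT D).
    by apply: le_trans (tn_ler htn It2 Iu) (le_trans uj (tn_lel htn _ _)).
  have [j kj uj] : exists2 j, dle k j & u <= tn (W d) (sval (F d) (x j)).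
    by apply: (Hd [set j | dle k j]); exists k.
  have IWF : 0 <= tn (W d) (sval (F d) (x j)) <= 1 by exact: (tn_itv htn).
  apply: (@le_trans _ _ (tn t2 (tn (W d) (sval (F d) (x j))))).
    exact: (le_tn htn).
  rewrite (tnC htn It2) // -(tnA htn) //.
  have IFt : 0 <= tn (sval (F d) (x j)) t2 <= 1 by exact: (tn_itv htn).
  apply: (le_tn htn) => //.
  apply: le_trans ((svalP (F d)).2 (x k) (x j)).
  by apply: (le_tn htn) => //; exact: Hi.
apply: (le_tn htn) => //; first exact: sub_hom_itv.
apply/(le_sub_hom htn) => // y.
rewrite (tnC htn) // -(le_implication htn) //.
have [I0 I1] := andP (implication_itv tn v (sval (F d) y)).
apply: net_liminf_le => // r Ir Hr; rewrite (le_implication htn) //.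
have [j [rj ij]] : ([set j | r <= h y (x j)] `&` [set j | dle i j]) !=set0.
  by apply: tails_nonempty; apply: tailsI => //; exists i.
apply: le_trans ((svalP (F d)).2 y (x j)); apply: (le_tn htn) => //.
by apply: inf01_le => [a /IA /andP[]|] //; exists j.
Qed.

(** For each x, F(x) & psi(x) <= sub(phi, F), and some x has phi(x) & psi(x)
    arbitrarily close to 1; at such a point the finite join defining c is taken
    over numbers and commutes with - & psi(x). *)
Lemma cauchy_weight_ideal phi : cauchy_weight tn h phi -> ideal tn h phi.
Proof.
have [Ih _ hT] := hX; move=> [wphi [psi [[Ipsi wpsi] phipsi psiphi]]].
have Iphi := wphi.1; apply/(idealP htn Ih wphi) => E W F c IW cE.
have IF d y : 0 <= sval (F d) y <= 1 by exact: (svalP (F d)).1.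
have Ic y : 0 <= sval c y <= 1 by exact: (svalP c).1.
set s := sub_hom tn phi (sval c); set J := weighted_join _ _ _.
have Is : 0 <= s <= 1 by exact: sub_hom_itv.
have IJ : 0 <= J <= 1.
  by apply: (weighted_join_itv htn) => // d; exact: sub_hom_itv.
apply: (le_tn_left1 htn Is) => t It t1.
have [|_ [x _ <-] /ltW tx] := lt_sup01 _ (lt_le_trans t1 phipsi).
  by case/andP: It.
have Ipp : 0 <= tn (phi x) (psi x) <= 1 by exact: (tn_itv htn).
apply: (@le_trans _ _ (tn (sval c x) (psi x))).
  apply: (@le_trans _ _ (tn (tn (phi x) (psi x)) s)); first exact: (le_tn htn).
  rewrite (tnC htn (Iphi x)) // -(tnA htn) // (tnC htn) //; last first.
    exact: (tn_itv htn).
  apply: (le_tn htn) => //; first exact: (tn_itv htn).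
  exact: (tn_sub_hom htn).
rewrite cE; apply/(tn_bigmax_le htn) => // [d||d]; first exact: (tn_itv htn).
  by case/andP: IJ.
rewrite -(tnA htn) //; apply: le_trans (le_bigmax _ _ d).
have IFp : 0 <= tn (sval (F d) x) (psi x) <= 1 by exact: (tn_itv htn).
apply: (le_tn htn) => //; first exact: sub_hom_itv.
apply/(le_sub_hom htn) => // y; rewrite (tnC htn) // -(tnA htn) //.
apply: le_trans ((svalP (F d)).2 y x); apply: (le_tn htn) => //.
exact: (tn_itv htn).
Qed.

Lemma representable_cauchy_weight phi :
  representable h phi -> cauchy_weight tn h phi.
Proof.
have [Ih h1 hT] := hX; case=> a E.
have wphi : weight tn h phi.
  by split=> [x|x y]; rewrite !E //; exact: hT.
split=> //; exists (h a); split.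
- by split=> // x y; exact: hT.
- apply: le_sup01; last by exists a; rewrite // E h1 (tn1x htn) ?itv1.
  by move=> _ [x _ <-]; case/andP: (tn_itv htn (wphi.1 x) (Ih a x)).
by move=> x y; rewrite E; exact: hT.
Qed.

End Ideals.

Theorem theorem3p21 (R : realType) (tn : R -> R -> R)
    (htn : continuous_tnorm tn)
    (X : Type) (h : X -> X -> R) (hX : real_enriched tn h) :
  [<-> smyth_complete h;
       (forall (D : directed_set) (x : D -> X),
          forward_cauchy h x -> exists! a, bilimit h x a);
       (separated_cat h /\ forall phi, ideal tn h phi -> representable h phi);
       (cauchy_complete tn h /\
          forall phi, ideal tn h phi -> cauchy_weight tn h phi)] /\
  (smyth_complete h -> yoneda_complete h).
Proof.
have bilim (D : directed_set) (x : D -> X) a :=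
  sym_converges_bilimit htn hX x a.
have bilimits : smyth_complete h -> forall (D : directed_set) (x : D -> X),
    forward_cauchy h x -> exists! a, bilimit h x a.
  move=> H D x /H[a [xa ua]]; exists a; split; first exact/bilim.
  by move=> b /bilim; exact: ua.
split; last first.
  move=> /bilimits H D x xC; have sep := bilimits_unique_separated htn hX H.
  have [a [xa _]] := H D x xC; exists a.
  split; first exact: bilimit_yoneda_limit.
  by move=> b; apply: (yoneda_limit_unique hX sep); exact: bilimit_yoneda_limit.
tfae=> //.
- move=> H; split; first exact: (bilimits_unique_separated htn hX H).
  move=> phi idphi.
  have [a [xa _]] := H _ _ (ideal_net_forward_cauchy htn hX idphi).
  by exists a => y; rewrite -(xa y).1 -(net_weight_ideal_net htn hX idphi).
- move=> [sep H]; split; last first.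
    by move=> phi /H; exact: (representable_cauchy_weight htn hX).
  by split=> // phi /(cauchy_weight_ideal htn hX)/H.
move=> [[sep H1] H2] D x xC.
have [a Ea] := H1 _ (H2 _ (net_weight_ideal htn hX xC)).
have xa : bilimit h x a by exact: (representing_bilimit htn hX).
exists a; split; first exact/bilim.
by move=> b /bilim; exact: (bilimit_unique hX sep xa).
Qed.
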